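(* Let $(\pi,[\![-]\!]_\pi)$ be a Kripke-sheaf model with Kripke sheaf $\pi:(D,R_D)\to(X,R_X)$, and let $(E,R_E)$ be an event model, where each event $e\in E$ has a closed precondition sentence $\mathrm{Pre}(e)$ with interpretation $[\![\mathrm{Pre}(e)]\!]_\pi\subseteq X$. Then the pullback update $(\pi_{X\otimes E},[\![-]\!]_{\pi_{X\otimes E}})$ of this model along $p_X:X\otimes E\to X$ is again a Kripke-sheaf model: $\pi_{X\otimes E}:(D_{X\otimes E},R_{D_{X\otimes E}})\to(X\otimes E,R_{X\otimes E})$ is a Kripke sheaf, and for each $n$-ary function symbol $f$ the updated interpretation $[\![f]\!]_{\pi_{X\otimes E}}$ is a monotone map over $X\otimes E$ from the $n$-fold fibered product of $D_{X\otimes E}$ over $X\otimes E$ to $D_{X\otimes E}$.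
   Context: Kripke frames are pairs $(X,R_X)$ with $R_X\subseteq X\times X$; a monotone map $f:(X,R_X)\to(Y,R_Y)$ is a function with $wR_Xv\Rightarrow f(w)R_Yf(v)$; a bounded morphism is a monotone map such that whenever $f(w)R_Yv'$ there is $v$ with $wR_Xv$ and $f(v)=v'$. A Kripke sheaf over $(X,R_X)$ is a bounded morphism $\pi:(D,R_D)\to(X,R_X)$ such that if $aR_Db$, $aR_Db'$ and $\pi(b)=\pi(b')$ then $b=b'$. For $n\in\mathbb N$, $D^n_X=\{(a_1,\dots,a_n)\in D^n\mid\pi(a_1)=\dots=\pi(a_n)\}$ (with $D^0_X=X$, $D^1_X=D$), with $\pi^n:D^n_X\to X$, $\bar a\mapsto\pi(a_i)$, and relation $\bar aR_{D^n_X}\bar b$ iff $a_iR_Db_i$ for all $i$ (the $n$-fold fibered product). A Kripke-sheaf model consists of a Kripke sheaf $\pi$ together with an interpretation assigning to each $n$-ary function symbol $f$ a monotone map $[\![f]\!]_\pi:D^n_X\to D$ over $X$ (i.e. $\pi\circ[\![f]\!]_\pi=\pi^n$), to each $n$-ary relation symbol $F$ a subset $[\![F]\!]_\pi\subseteq D^n_X$, and thereby interpretations of all terms and formulas-in-context. An event model is a Kripke frame $(E,R_E)$ with preconditions as stated. The product update is $X\otimes E=\{(w,e)\in X\times E\mid w\in[\![\mathrm{Pre}(e)]\!]_\pi\}$ with $(w_1,e_1)R_{X\otimes E}(w_2,e_2)$ iff $w_1R_Xw_2$ and $e_1R_Ee_2$, and $p_X(w,e)=w$. The pullback update pulls the model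 back along $p_X$ in the category of Kripke frames and monotone maps: $D_{X\otimes E}=\{(a,e)\in D\times E\mid\pi(a)\in[\![\mathrm{Pre}(e)]\!]_\pi\}$ with $(a,e_1)R_{D_{X\otimes E}}(b,e_2)$ iff $aR_Db$ and $e_1R_Ee_2$, and $\pi_{X\otimes E}(a,e)=(\pi(a),e)$; its $n$-fold fibered product over $X\otimes E$ is identified with $D^n_{X\otimes E}=\{(\bar a,e)\in D^n_X\times E\mid\pi^n(\bar a)\in[\![\mathrm{Pre}(e)]\!]_\pi\}$ with $(\bar a,e_1)R(\bar b,e_2)$ iff $a_iR_Db_i$ for all $i$ and $e_1R_Ee_2$; $[\![f]\!]_{\pi_{X\otimes E}}(\bar a,e)=([\![f]\!]_\pi(\bar a),e)$ and $[\![F]\!]_{\pi_{X\otimes E}}=\{(\bar a,e)\in D^n_{X\otimes E}\mid\bar a\in[\![F]\!]_\pi\}$. *)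

(* Defs.v *)
From mathcomp Require Import all_boot.

Set Implicit Arguments.
Unset Strict Implicit.
Unset Printing Implicit Defensive.

Record frame := Frame {
  carrier :> Type;
  acc : carrier -> carrier -> Prop
}.
Arguments acc {f} _ _.

Definition monotone (X Y : frame) (f : X -> Y) : Prop :=
  forall w v : X, acc w v -> acc (f w) (f v).

Definition bounded_morphism (X Y : frame) (f : X -> Y) : Prop :=
  monotone f /\
  forall (w : X) (v' : Y), acc (f w) v' -> exists v : X, acc w v /\ f v = v'.

Definition kripke_sheaf (D X : frame) (pi : D -> X) : Prop :=
  bounded_morphism pi /\
  forall a b b' : D, acc a b -> acc a b' -> pi b = pi b' -> b = b'.

(* The carrier of the n-fold fibered product D^n_X. The common value of pi on
   the tuple is stored as [fbase], so that for n = 0 this is X itself with its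
   own relation (and not a one-point set); for n > 0 both [fbase] and the
   first conjunct of [facc] are determined by the tuple when pi is monotone. *)
Record fpow_carrier (D X : frame) (pi : D -> X) (n : nat) := FPow {
  fbase : X;
  ftup : n.-tuple D;
  fpowP : forall i : 'I_n, pi (tnth ftup i) = fbase
}.

Definition facc (D X : frame) (pi : D -> X) (n : nat)
    (a b : fpow_carrier pi n) : Prop :=
  acc (fbase a) (fbase b) /\
  forall i : 'I_n, acc (tnth (ftup a) i) (tnth (ftup b) i).

Definition fpow (D X : frame) (pi : D -> X) (n : nat) : frame :=
  Frame (@facc D X pi n).

Definition fpow_nil (D X : frame) (pi : D -> X) (w : X) : fpow pi 0.
Proof. by exists w [tuple]; case. Defined.

Definition fpow_cons (D X : frame) (pi : D -> X) (n : nat) (a : fpow pi n)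
    (b : D) (hb : pi b = fbase a) : fpow pi n.+1.
Proof.
exists (fbase a) [tuple of b :: ftup a] => i.
by case: (unliftP ord0 i) => [j ->|->]; rewrite ?tnthS ?tnth0 //; apply: fpowP.
Defined.

(* The point of D^k_X over w with the given components. *)
Definition fpow_mk (D X : frame) (pi : D -> X) (k : nat) (w : X)
    (d : 'I_k -> {b : D | pi b = w}) : fpow pi k.
Proof.
exists w [tuple sval (d i) | i < k] => i.
by rewrite tnth_mktuple; apply: (svalP (d i)).
Defined.

Record signature := Signature {
  fsym : Type;
  rsym : Type;
  farity : fsym -> nat;
  rarity : rsym -> nat
}.
Arguments farity {s} _.
Arguments rarity {s} _.

(* Terms and formulas in a context of n variables. A quantifier binds the
   variable 0 of its body and shifts the variables of the ambient context. *)
Inductive term (S : signature) (n : nat) : Type :=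
| Var (i : 'I_n)
| App (f : fsym S) (ts : 'I_(farity f) -> term S n).

Inductive formula (S : signature) : nat -> Type :=
| Rel n (F : rsym S) (ts : 'I_(rarity F) -> term S n) : formula S n
| Equ n (s t : term S n) : formula S n
| Bot n : formula S n
| Neg n (phi : formula S n) : formula S n
| And n (phi psi : formula S n) : formula S n
| Or n (phi psi : formula S n) : formula S n
| Imp n (phi psi : formula S n) : formula S n
| All n (phi : formula S n.+1) : formula S n
| Ex n (phi : formula S n.+1) : formula S n
| Box n (phi : formula S n) : formula S n
| Dia n (phi : formula S n) : formula S n.

Definition sentence (S : signature) : Type := formula S 0.

Record interpretation (S : signature) (D X : frame) (pi : D -> X) :=
  Interpretation {
    ifun : forall f : fsym S, fpow pi (farity f) -> D;
    irel : forall F : rsym S, fpow pi (rarity F) -> Prop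
  }.

Record is_kripke_sheaf_model (S : signature) (D X : frame) (pi : D -> X)
    (I : interpretation S pi) : Prop := IsKripkeSheafModel {
  model_sheaf : kripke_sheaf pi;
  model_ifun_monotone : forall f : fsym S, monotone (ifun I (f := f));
  model_ifun_over :
    forall (f : fsym S) (a : fpow pi (farity f)), pi (ifun I a) = fbase a
}.

Record model (S : signature) := Model {
  world : frame;
  domain : frame;
  proj : domain -> world;
  interp : interpretation S proj;
  modelP : is_kripke_sheaf_model interp
}.

Section Semantics.
Variables (S : signature) (M : model S).

Fixpoint term_interp (n : nat) (t : term S n) (a : fpow (@proj S M) n) :
    {b : domain M | proj b = fbase a} :=
  match t with
  | Var i => exist _ (tnth (ftup a) i) (fpowP a i)
  | App f ts =>
      let args := fpow_mk (fun i => term_interp (ts i) a) in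
      exist _ (ifun (interp M) args) (model_ifun_over (modelP M) args)
  end.

Fixpoint formula_interp (n : nat) (phi : formula S n) :
    fpow (@proj S M) n -> Prop :=
  match phi in formula _ n return fpow (@proj S M) n -> Prop with
  | Rel _ F ts => fun a =>
      irel (interp M) (fpow_mk (fun i => term_interp (ts i) a))
  | Equ _ s t => fun a => sval (term_interp s a) = sval (term_interp t a)
  | Bot _ => fun a => False
  | Neg _ phi => fun a => ~ formula_interp phi a
  | And _ phi psi => fun a => formula_interp phi a /\ formula_interp psi a
  | Or _ phi psi => fun a => formula_interp phi a \/ formula_interp psi a
  | Imp _ phi psi => fun a => formula_interp phi a -> formula_interp psi a
  | All _ phi => fun a =>
      forall (b : domain M) (hb : proj b = fbase a),
        formula_interp phi (fpow_cons hb)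
  | Ex _ phi => fun a =>
      exists (b : domain M) (hb : proj b = fbase a),
        formula_interp phi (fpow_cons hb)
  | Box _ phi => fun a => forall b, acc a b -> formula_interp phi b
  | Dia _ phi => fun a => exists b, acc a b /\ formula_interp phi b
  end.

Definition sentence_interp (phi : sentence S) (w : world M) : Prop :=
  formula_interp phi (fpow_nil (@proj S M) w).

End Semantics.

Record event_model (S : signature) := EventModel {
  event : frame;
  pre : event -> sentence S
}.

Section Update.
Variables (S : signature) (M : model S) (E : event_model S).

Local Notation pi := (@proj S M).

Definition upd_world : frame :=
  @Frame {p : world M * event E | sentence_interp (pre p.2) p.1}
    (fun p q => acc (sval p).1 (sval q).1 /\ acc (sval p).2 (sval q).2).

Definition upd_domain : frame :=
  @Frame {p : domain M * event E | sentence_interp (pre p.2) (pi p.1)}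
    (fun p q => acc (sval p).1 (sval q).1 /\ acc (sval p).2 (sval q).2).

Definition upd_proj (p : upd_domain) : upd_world :=
  exist _ (pi (sval p).1, (sval p).2) (svalP p).

(* The identification of the n-fold fibered product of upd_domain over
   upd_world with pairs (a, e) such that pi^n(a) satisfies pre e: the first
   component is [fpow_fst c] and the second is [fpow_snd c]. *)
Definition fpow_fst (n : nat) (c : fpow upd_proj n) : fpow pi n.
Proof.
exists (sval (fbase c)).1 [tuple (sval (tnth (ftup c) i)).1 | i < n] => i.
by rewrite tnth_mktuple -(fpowP c i).
Defined.

Definition fpow_snd (n : nat) (c : fpow upd_proj n) : event E :=
  (sval (fbase c)).2.

Lemma fpow_pre (n : nat) (c : fpow upd_proj n) :
  sentence_interp (pre (fpow_snd c)) (fbase (fpow_fst c)).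
Proof. exact: (svalP (fbase c)). Qed.

Lemma upd_ifun_pre (f : fsym S) (c : fpow upd_proj (farity f)) :
  sentence_interp (pre (fpow_snd c)) (pi (ifun (interp M) (fpow_fst c))).
Proof. by rewrite (model_ifun_over (modelP M)); apply: fpow_pre. Qed.

Definition upd_ifun (f : fsym S) (c : fpow upd_proj (farity f)) : upd_domain :=
  exist _ (ifun (interp M) (fpow_fst c), fpow_snd c) (upd_ifun_pre c).

Definition upd_irel (F : rsym S) (c : fpow upd_proj (rarity F)) : Prop :=
  irel (interp M) (fpow_fst c).

Definition upd_interp : interpretation S upd_proj :=
  Interpretation upd_ifun upd_irel.

End Update.

(* Main.v *)
Require Import Defs.
From mathcomp Require Import all_boot.
From Stdlib Require Import ProofIrrelevance.

(** [Pre] restricts [(a, e)] only through [pi a], so a lift along [pi] paired with the target event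
    survives the update. Uniqueness of lifts comes from [pi] in the domain component and from
    equality of projections in the event component. Function symbols act on the domain component
    only and keep the event. *)

Lemma sval_injective (T : Type) (P : T -> Prop) : injective (@sval T P).
Proof. by move=> u v; apply: eq_sig_hprop => x; apply: proof_irrelevance. Qed.

Lemma upd_proj_bounded (S : signature) (M : model S) (E : event_model S) :
  bounded_morphism (@upd_proj S M E).
Proof.
have [[pi_mono pi_lift] _] := model_sheaf (modelP M).
split=> [p q [pqD pqE]|]; first by split; [apply: pi_mono|].
move=> [[a e] pre_a] [[w' e'] pre_w'] [/= /pi_lift[b [ab eq_b]] ee'].
(* With [w'] replaced by [pi b], [pre_w'] is itself the proof that [(b, e')] survives. *)
subst w'; exists (exist _ (b, e') pre_w'); split; first by split.
exact: sval_injective.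
Qed.

Lemma upd_proj_sheaf (S : signature) (M : model S) (E : event_model S) :
  kripke_sheaf (@upd_proj S M E).
Proof.
split; first exact: upd_proj_bounded.
have [_ pi_uniq] := model_sheaf (modelP M).
move=> [[a e] pre_a] [[b eb] pre_b] [[b' eb'] pre_b'] [/= ab _] [/= ab' _].
move=> /(congr1 sval) [/(pi_uniq _ _ _ ab ab') eq_b eq_e].
by apply: sval_injective; rewrite /= eq_b eq_e.
Qed.

Theorem theorem4p5 (S : signature) (M : model S) (E : event_model S) :
  is_kripke_sheaf_model (upd_interp M E).
Proof.
split; first exact: upd_proj_sheaf.
- move=> f c d [[accX accE] accD]; split=> //=.
  apply: (model_ifun_monotone (modelP M)); split=> //= i.
  by rewrite !tnth_mktuple; case: (accD i).
- move=> f c; apply: sval_injective; rewrite /= (model_ifun_over (modelP M)).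
  (* What remains is surjective pairing for the base point of [c]. *)
  by rewrite /fpow_snd /=; case: (sval (fbase c)).
Qed.
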